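(* Let $G$ be a matroid on $[n]$ with no loops and no multiple points, $\mathbb{K}$ a field or commutative ring, $r\ge1$, and fix a linear order on $[n]$. Then the images in $A_r(G)$ of the monomials $e_S$, $S$ ranging over the $r$-nbb sets of $G$, form a linearly independent set.
   Context: $\mathcal{E}$ is the exterior algebra over $\mathbb{K}$ on $e_1,\dots,e_n$, $e_S=e_{i_1}\cdots e_{i_p}$ for $S=\{i_1<\dots<i_p\}$; $\partial(e_{i_1}\cdots e_{i_p})=\sum_k(-1)^{k-1}e_{i_1}\cdots\widehat{e_{i_k}}\cdots e_{i_p}$; $\mathcal{I}$ is the ideal generated by $\partial e_S$ for dependent $S$; $\mathcal{J}_r$ is the ideal generated by elements of $\mathcal{I}$ of degree $\le r$; $A_r(G)=\mathcal{E}/\mathcal{J}_r$. A subset of $[n]$ is $r$-closed if it contains the matroid closures of all its $p$-subsets for all $p\le r$; the $r$-closure of $S$ is the intersection of all $r$-closed sets containing $S$. An increasing subset $S=\{i_1<\dots<i_p\}$ is $r$-nbb if, for each $k$, $i_k$ is the smallest element of the $r$-closure of $\{i_k,\dots,i_p\}$. *)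

(* Defs.v *)
From HB Require Import structures.
From mathcomp Require Import all_boot all_order all_algebra.
From mathcomp Require Import boolp.
From mathcomp Require classical_sets.

Set Implicit Arguments.
Unset Strict Implicit.
Unset Printing Implicit Defensive.

Import GRing.Theory.
Local Open Scope ring_scope.

Record matroid (T : finType) := Matroid {
  indep : pred {set T};
  indep0 : indep set0;
  indepS : forall A B : {set T}, A \subset B -> indep B -> indep A;
  indep_aug : forall A B : {set T}, indep A -> indep B -> (#|A| < #|B|)%N ->
    exists2 x, x \in B :\: A & indep (x |: A)
}.

Section Matroid.
Variables (T : finType) (M : matroid T).
Implicit Types S X : {set T}.

Definition no_loops := forall i, indep M [set i].

Definition no_multiple_points :=
  forall i j, indep M [set i] -> indep M [set j] -> i != j ->
    indep M [set i; j].

Definition rank S : nat := \max_(A : {set T} | (A \subset S) && indep M A) #|A|.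

Definition cl S : {set T} := [set x | rank (x |: S) == rank S].

Variable r : nat.

Definition rclosed X : bool :=
  [forall S : {set T}, (S \subset X) && (#|S| <= r)%N ==> (cl S \subset X)].

Definition rcl S : {set T} :=
  \bigcap_(X : {set T} | rclosed X && (S \subset X)) X.

Variable le : rel T.

Definition linear_order :=
  [/\ reflexive le, antisymmetric le, transitive le & total le].

Definition smallest_in (i : T) X : bool :=
  (i \in X) && [forall j in X, le i j].

Definition rnbb S : bool :=
  [forall i in S, smallest_in i (rcl [set j in S | le i j])].

End Matroid.

(* The exterior algebra on e_0, ..., e_(n-1): an element is given by its      *)
(* coordinates in the basis of the monomials e_S, e_S being the product of    *)
(* the e_i, i in S, in increasing order (see exmon_enum below). K may be the  *)
(* zero ring, so the algebra is only a pzRingType and an lmodType.            *)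
Record exterior (K : comPzRingType) (n : nat) :=
  Exterior { excoef : {ffun {set 'I_n} -> K} }.

HB.instance Definition _ K n := [isNew for @excoef K n].
HB.instance Definition _ K n := [Choice of exterior K n by <:].

Section Exterior.
Variables (K : comPzRingType) (n : nat).
Local Notation E := (exterior K n).
Implicit Types (x y z : E) (S T U V : {set 'I_n}) (a b : K).

Definition exbuild (f : {set 'I_n} -> K) : E := Exterior [ffun S => f S].

Arguments excoef : simpl never.

Lemma exbuildE f S : excoef (exbuild f) S = f S.
Proof. by rewrite ffunE. Qed.

Lemma exterior_eqP x y : (forall S, excoef x S = excoef y S) <-> x = y.
Proof. by split=> [h|-> //]; apply/val_inj/ffunP. Qed.

Definition exzero := exbuild (fun=> 0).
Definition exopp x := exbuild (fun S => - excoef x S).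
Definition exadd x y := exbuild (fun S => excoef x S + excoef y S).
Definition exscale a x := exbuild (fun S => a * excoef x S).

Fact exaddA : associative exadd.
Proof. by move=> x y z; apply/exterior_eqP=> S; rewrite !exbuildE addrA. Qed.
Fact exaddC : commutative exadd.
Proof. by move=> x y; apply/exterior_eqP=> S; rewrite !exbuildE addrC. Qed.
Fact exadd0 : left_id exzero exadd.
Proof. by move=> x; apply/exterior_eqP=> S; rewrite !exbuildE add0r. Qed.
Fact exaddN : left_inverse exzero exopp exadd.
Proof. by move=> x; apply/exterior_eqP=> S; rewrite !exbuildE addNr. Qed.

HB.instance Definition _ :=
  GRing.isZmodule.Build E exaddA exaddC exadd0 exaddN.

Lemma excoef0 S : excoef (0 : E) S = 0. Proof. exact: exbuildE. Qed.
Lemma excoefN x S : excoef (- x) S = - excoef x S. Proof. exact: exbuildE. Qed.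
Lemma excoefD x y S : excoef (x + y) S = excoef x S + excoef y S.
Proof. exact: exbuildE. Qed.
Lemma excoef_sum I (s : seq I) (P : pred I) (F : I -> E) S :
  excoef (\sum_(i <- s | P i) F i) S = \sum_(i <- s | P i) excoef (F i) S.
Proof.
by apply: (big_morph (fun x => excoef x S)) => [x y|];
  rewrite ?excoefD ?excoef0.
Qed.

Fact exscaleA a b x : exscale a (exscale b x) = exscale (a * b) x.
Proof. by apply/exterior_eqP=> S; rewrite !exbuildE mulrA. Qed.
Fact exscale1 : left_id 1 exscale.
Proof. by move=> x; apply/exterior_eqP=> S; rewrite !exbuildE mul1r. Qed.
Fact exscaleDr : right_distributive exscale +%R.
Proof.
by move=> a x y; apply/exterior_eqP=> S; rewrite !(exbuildE, excoefD) mulrDr.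
Qed.
Fact exscaleDl x : {morph exscale^~ x : a b / a + b}.
Proof.
by move=> a b; apply/exterior_eqP=> S; rewrite !(exbuildE, excoefD) mulrDl.
Qed.

HB.instance Definition _ :=
  GRing.Zmodule_isLmodule.Build K E exscaleA exscale1 exscaleDr exscaleDl.

Lemma excoefZ a x S : excoef (a *: x) S = a * excoef x S.
Proof. exact: exbuildE. Qed.

(* The number of inversions of enum S ++ enum T. *)
Definition exinv S T : nat := (\sum_(i in S) \sum_(j in T) (j < i))%N.

(* e_S e_T = (-1) ^ exinv S T e_(S :|: T) if S and T are disjoint, and 0      *)
(* otherwise, extended bilinearly.                                            *)
Definition exmul x y : E := exbuild (fun U =>
  \sum_(S : {set 'I_n} | S \subset U)
     (-1) ^+ exinv S (U :\: S) * (excoef x S * excoef y (U :\: S))).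

Definition exbasis U : E := exbuild (fun S => (S == U)%:R).

Definition exone : E := exbasis set0.

Lemma setUDK S T : S \subset T -> S :|: (T :\: S) = T.
Proof. by move=> ST; rewrite setDE setUIr setUCr setIT; apply/setUidPr. Qed.

Lemma exinv0l T : exinv set0 T = 0%N.
Proof. by rewrite /exinv big_set0. Qed.

Lemma exinv0r S : exinv S set0 = 0%N.
Proof. by rewrite /exinv big1 // => i _; rewrite big_set0. Qed.

Lemma exinvUl S T U : [disjoint S & T] ->
  exinv (S :|: T) U = (exinv S U + exinv T U)%N.
Proof. by move=> dST; rewrite /exinv -bigU //; apply: eq_bigl => i; rewrite !inE. Qed.

Lemma exinvUr S T U : [disjoint T & U] ->
  exinv S (T :|: U) = (exinv S T + exinv S U)%N.
Proof.
move=> dTU; rewrite /exinv -big_split; apply: eq_bigr => i _.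
by rewrite -bigU //; apply: eq_bigl => j; rewrite !inE.
Qed.

Fact exmulA : associative exmul.
Proof.
move=> x y z; apply/exterior_eqP=> U; rewrite !exbuildE; symmetry.
under eq_bigr do rewrite exbuildE mulr_suml mulr_sumr.
rewrite (exchange_big_dep (fun S : {set 'I_n} => S \subset U)) /=; last first.
  by move=> V S VU SV; apply: subset_trans SV VU.
apply: eq_bigr => S SU; rewrite exbuildE !mulr_sumr.
rewrite (reindex_onto (fun T => S :|: T) (fun V => V :\: S)) /=; last first.
  by move=> V /andP[_ SV]; rewrite setUDK.
apply: eq_big => [T|T].
  rewrite subUset SU subsetUl andbT subsetD /= setDUl setDv set0U.
  by rewrite (sameP eqP setDidPl) disjoint_sym.
rewrite subUset SU subsetUl andbT setDUl setDv set0U /= => /andP[TU /eqP TS].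
have dST : [disjoint S & T] by rewrite disjoint_sym; apply/setDidPl.
have defU : U :\: S = T :|: (U :\: S :\: T).
  by rewrite setUDK // subsetD TU disjoint_sym.
have dT : [disjoint T & U :\: S :\: T].
  by rewrite disjoint_sym -setI_eq0 setDE -setIA [~: T :&: T]setIC setICr setI0.
rewrite TS -setDDl [in exinv S (U :\: S)]defU exinvUl // exinvUr // !exprD.
by rewrite !mulrA [RHS](ACl (2*4*1*3*5*6)).
Qed.

Fact exmul1l : left_id (exone) exmul.
Proof.
move=> x; apply/exterior_eqP=> U; rewrite exbuildE (bigD1 set0) ?sub0set //=.
rewrite big1 => [|S /andP[_ /negPf S0]]; last by rewrite exbuildE S0 mul0r mulr0.
by rewrite exinv0l exbuildE eqxx !mul1r setD0 addr0.
Qed.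

Fact exmul1r : right_id (exone) exmul.
Proof.
move=> x; apply/exterior_eqP=> U; rewrite exbuildE (bigD1 U) //=.
rewrite big1 => [|S /andP[SU nSU]].
  by rewrite setDv exinv0r exbuildE eqxx mulr1 mul1r addr0.
have /negPf nUS0 : U :\: S != set0.
  by apply: contra nSU; rewrite setD_eq0 eqEsubset SU.
by rewrite exbuildE nUS0 !mulr0.
Qed.

Fact exmulDl : left_distributive exmul +%R.
Proof.
move=> x y z; apply/exterior_eqP=> U; rewrite excoefD !exbuildE -big_split.
by apply: eq_bigr => S _; rewrite excoefD mulrDl mulrDr.
Qed.

Fact exmulDr : right_distributive exmul +%R.
Proof.
move=> x y z; apply/exterior_eqP=> U; rewrite excoefD !exbuildE -big_split.
by apply: eq_bigr => S _; rewrite excoefD !mulrDr.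
Qed.

HB.instance Definition _ :=
  GRing.Zmodule_isPzRing.Build E exmulA exmul1l exmul1r exmulDl exmulDr.

Lemma excoefM x y U :
  excoef (x * y) U = \sum_(S : {set 'I_n} | S \subset U)
     (-1) ^+ exinv S (U :\: S) * (excoef x S * excoef y (U :\: S)).
Proof. exact: exbuildE. Qed.

Lemma exscalerAl a x y : a *: (x * y) = a *: x * y.
Proof.
apply/exterior_eqP=> U; rewrite excoefZ !excoefM mulr_sumr.
by apply: eq_bigr => S _; rewrite excoefZ mulrCA -[in RHS]mulrA.
Qed.

Lemma exscalerAr a x y : a *: (x * y) = x * (a *: y).
Proof.
apply/exterior_eqP=> U; rewrite excoefZ !excoefM mulr_sumr.
by apply: eq_bigr => S _; rewrite excoefZ mulrCA; congr (_ * _); rewrite mulrCA.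
Qed.

Lemma excoef_basis S U : excoef (exbasis U) S = (S == U)%:R.
Proof. exact: exbuildE. Qed.

Lemma exbasis_decomp x : x = \sum_S excoef x S *: exbasis S.
Proof.
apply/exterior_eqP=> U; rewrite excoef_sum (bigD1 U) //= big1 => [|S nSU].
  by rewrite addr0 excoefZ excoef_basis eqxx mulr1.
by rewrite excoefZ excoef_basis eq_sym (negPf nSU) mulr0.
Qed.

Lemma exbasisM S T : exbasis S * exbasis T =
  if [disjoint S & T] then (-1) ^+ exinv S T *: exbasis (S :|: T) else 0.
Proof.
apply/exterior_eqP=> U; rewrite excoefM.
have [SU|nSU] := boolP (S \subset U); last first.
  rewrite big1 => [|A AU]; last first.
    by rewrite excoef_basis; case: eqP nSU => [<-|]; rewrite ?AU ?mul0r ?mulr0.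
  case: ifP => _; rewrite ?excoef0 // excoefZ excoef_basis.
  by case: eqP nSU => [->|]; rewrite ?subsetUl ?mulr0.
rewrite (bigD1 S) //= big1 => [|A /andP[_ /negPf nAS]]; last first.
  by rewrite excoef_basis nAS mul0r mulr0.
rewrite addr0 !excoef_basis eqxx mul1r.
case: ifPn => [dST|ndST].
  rewrite excoefZ excoef_basis; case: eqP => [<-|nT]; first by rewrite setUDK ?eqxx.
  case: eqP => [defU|]; last by rewrite !mulr0.
  case: nT; rewrite defU setDUl setDv set0U; apply/setDidPl.
  by rewrite disjoint_sym.
rewrite excoef0; case: eqP => [defT|]; last by rewrite mulr0.
by case/negP: ndST; rewrite -defT -setI_eq0 setDE setICA setICr setI0.
Qed.

Definition exgen (i : 'I_n) : E := exbasis [set i].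

Lemma exgen_sqr i : exgen i * exgen i = 0.
Proof. by rewrite exbasisM disjoints1 inE eqxx. Qed.

Lemma exgen_anticomm i j : exgen i * exgen j = - (exgen j * exgen i).
Proof.
have [->|nij] := eqVneq i j; first by rewrite exgen_sqr oppr0.
rewrite !exbasisM !disjoints1 !inE nij eq_sym nij setUC /exinv !big_set1.
case: ltngtP; rewrite ?expr0 ?expr1 ?scaleN1r ?scale1r ?opprK // => /val_inj eji.
by rewrite eji eqxx in nij.
Qed.

Definition exmon (s : seq 'I_n) : E := \prod_(i <- s) exgen i.

Lemma exmon_sorted (s : seq 'I_n) :
  sorted (fun i j : 'I_n => i < j)%N s -> exmon s = exbasis [set i in s].
Proof.
rewrite /exmon; elim: s => [_|i s IHs].
  by rewrite big_nil; congr exbasis; apply/setP=> j; rewrite !inE.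
rewrite /= (path_sortedE (fun _ _ _ => @ltn_trans _ _ _)) => /andP[/allP lti ss].
rewrite big_cons IHs // exbasisM disjoints1 inE.
have -> : i \notin s by apply/negP=> /lti; rewrite ltnn.
rewrite -set_cons.
by rewrite /exinv big_set1 big1 ?expr0 ?scale1r // => j; rewrite inE => /lti/ltnW;
   case: ltngtP.
Qed.

(* enum S lists S in increasing order. *)
Lemma exmon_enum S : exmon (enum S) = exbasis S.
Proof.
rewrite exmon_sorted; first by congr exbasis; apply/setP=> i; rewrite inE mem_enum.
rewrite {1}/enum_mem -enumT; apply: sorted_filter.
  by move=> *; apply: ltn_trans; eassumption.
by have := iota_ltn_sorted 0 n; rewrite -val_enum_ord sorted_map.
Qed.

Definition exbdry_mon (s : seq 'I_n) : E :=
  \sum_(k < size s) (-1) ^+ k *: exmon (take k s ++ drop k.+1 s).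

(* As exbdry is linear, it is enough to give it on the monomials e_S.         *)
Definition exbdry x : E := \sum_S excoef x S *: exbdry_mon (enum S).

Lemma exbdry_enum S : exbdry (exmon (enum S)) = exbdry_mon (enum S).
Proof.
rewrite exmon_enum /exbdry (bigD1 S) //= big1 => [|T /negPf nTS].
  by rewrite excoef_basis eqxx scale1r addr0.
by rewrite excoef_basis nTS scale0r.
Qed.

Definition exdeg_le (r : nat) x : Prop :=
  forall S, (r < #|S|)%N -> excoef x S = 0.

End Exterior.

Arguments excoef : simpl never.

(* The library only has quotients of commutative rings by ideals. *)
Section Ideals.
Variable R : pzRingType.

Record two_sided_ideal (I : classical_sets.set R) : Prop := TwoSidedIdeal {
  ideal0 : I 0;
  idealD : forall x y, I x -> I y -> I (x + y);
  ideal_mull : forall a x, I x -> I (a * x);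
  ideal_mulr : forall a x, I x -> I (x * a)
}.

Definition ideal_gen (X : classical_sets.set R) : classical_sets.set R :=
  classical_sets.smallest two_sided_ideal X.

Lemma ideal_genP X : two_sided_ideal (ideal_gen X).
Proof.
split=> [I [iI _]|x y Ix Iy I XI|a x Ix I XI|a x Ix I XI]; first exact: ideal0.
- by apply: idealD XI.1 _ _ _ _; [apply: Ix | apply: Iy].
- by apply: ideal_mull XI.1 _ _ _; apply: Ix.
- by apply: ideal_mulr XI.1 _ _ _; apply: Ix.
Qed.

Variable X : classical_sets.set R.

Definition ideal_pred : {pred R} := fun x => `[< ideal_gen X x >].

Lemma ideal_predP x : reflect (ideal_gen X x) (x \in ideal_pred).
Proof. exact: asboolP. Qed.

Fact ideal_pred_zmod : zmod_closed ideal_pred.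
Proof.
have [I0 ID Il _] := ideal_genP X.
split=> [|x y /ideal_predP Ix /ideal_predP Iy]; apply/ideal_predP => //.
by apply: ID => //; rewrite -mulN1r; apply: Il.
Qed.

HB.instance Definition _ := GRing.isZmodClosed.Build R ideal_pred ideal_pred_zmod.

Definition quot_ring := Quotient.quot ideal_pred.

HB.instance Definition _ := GRing.Zmodule.on quot_ring.

Definition quot_proj (x : R) : quot_ring := \pi_(Quotient.quot ideal_pred)%qT x.

Definition quot_repr (u : quot_ring) : R := repr u.

Lemma quot_reprK u : quot_proj (quot_repr u) = u.
Proof. exact: reprK. Qed.

Lemma quot_projP x y : quot_proj x = quot_proj y <-> ideal_gen X (x - y).
Proof.
rewrite /quot_proj; split=> [/eqP|/ideal_predP].
  by rewrite -Quotient.idealrBE => /ideal_predP.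
by rewrite Quotient.idealrBE => /eqP.
Qed.

Fact quot_proj_zmod : zmod_morphism quot_proj.
Proof. exact: (raddfB (\pi_(Quotient.quot ideal_pred)%qT)). Qed.

HB.instance Definition _ :=
  GRing.isZmodMorphism.Build R quot_ring quot_proj quot_proj_zmod.

Definition quot_one : quot_ring := quot_proj 1.
Definition quot_mul (u v : quot_ring) : quot_ring :=
  quot_proj (quot_repr u * quot_repr v).

Lemma quot_projM x y : quot_proj (x * y) = quot_mul (quot_proj x) (quot_proj y).
Proof.
have [I0 ID Il Ir] := ideal_genP X.
apply/quot_projP; set x' := quot_repr _; set y' := quot_repr _.
have -> : x * y - x' * y' = x * (y - y') + (x - x') * y'.
  by rewrite mulrBr mulrBl addrA addrNK.
by apply: ID; [apply: Il | apply: Ir]; apply/quot_projP; rewrite quot_reprK.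
Qed.

Fact quot_mulA : associative quot_mul.
Proof.
move=> u v w; rewrite -[u]quot_reprK -[v]quot_reprK -[w]quot_reprK.
by rewrite -!quot_projM mulrA.
Qed.
Fact quot_mul1l : left_id quot_one quot_mul.
Proof. by move=> u; rewrite -[u]quot_reprK -quot_projM mul1r. Qed.
Fact quot_mul1r : right_id quot_one quot_mul.
Proof. by move=> u; rewrite -[u]quot_reprK -quot_projM mulr1. Qed.
Fact quot_mulDl : left_distributive quot_mul +%R.
Proof.
move=> u v w; rewrite -[u]quot_reprK -[v]quot_reprK -[w]quot_reprK.
by rewrite -raddfD -!quot_projM mulrDl raddfD.
Qed.
Fact quot_mulDr : right_distributive quot_mul +%R.
Proof.
move=> u v w; rewrite -[u]quot_reprK -[v]quot_reprK -[w]quot_reprK.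
by rewrite -raddfD -!quot_projM mulrDr raddfD.
Qed.

HB.instance Definition _ := GRing.Zmodule_isPzRing.Build quot_ring
  quot_mulA quot_mul1l quot_mul1r quot_mulDl quot_mulDr.

Fact quot_proj_monoid : monoid_morphism quot_proj.
Proof. by split=> // x y; rewrite quot_projM. Qed.

HB.instance Definition _ :=
  GRing.isMonoidMorphism.Build R quot_ring quot_proj quot_proj_monoid.

End Ideals.

Section OrlikSolomon.
Variables (K : comPzRingType) (n : nat) (M : matroid 'I_n).
Local Notation E := (exterior K n).

(* The natural order of 'I_n is used here; for another linear order e_S and   *)
(* its boundary change only by a common sign, so the ideal is the same.       *)
Definition os_ideal : classical_sets.set E :=
  ideal_gen (fun x => exists2 S : {set 'I_n},
    ~~ indep M S & x = exbdry (exmon K (enum S))).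

Variable r : nat.

Definition os_trunc_gen : classical_sets.set E :=
  fun x => os_ideal x /\ exdeg_le r x.

Definition os_trunc : classical_sets.set E := ideal_gen os_trunc_gen.

Definition os_alg := quot_ring os_trunc_gen.

HB.instance Definition _ := GRing.PzRing.on os_alg.

Definition os_proj : E -> os_alg := @quot_proj E os_trunc_gen.

HB.instance Definition _ := GRing.RMorphism.on os_proj.

Lemma os_projP x : os_proj x = 0 <-> os_trunc x.
Proof. by rewrite -[0](raddf0 os_proj) /os_proj quot_projP subr0. Qed.

Definition os_scale (a : K) (u : os_alg) : os_alg := os_proj (a *: (1 : E)) * u.

Fact os_scaleA a b u : os_scale a (os_scale b u) = os_scale (a * b) u.
Proof. by rewrite /os_scale mulrA -rmorphM /= -exscalerAl mul1r scalerA. Qed.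
Fact os_scale1 : left_id 1 os_scale.
Proof. by move=> u; rewrite /os_scale scale1r rmorph1 mul1r. Qed.
Fact os_scaleDr : right_distributive os_scale +%R.
Proof. by move=> a u v; rewrite /os_scale mulrDr. Qed.
Fact os_scaleDl u : {morph os_scale^~ u : a b / a + b}.
Proof. by move=> a b; rewrite /os_scale scalerDl rmorphD mulrDl. Qed.

HB.instance Definition _ := GRing.Zmodule_isLmodule.Build K os_alg
  os_scaleA os_scale1 os_scaleDr os_scaleDl.

Lemma os_projZ a x : os_proj (a *: x) = a *: os_proj x.
Proof.
rewrite [RHS](_ : _ = os_proj (a *: (1 : E)) * os_proj x) //.
by rewrite -rmorphM /= -exscalerAl mul1r.
Qed.

Fact os_proj_scalable : scalable os_proj.
Proof. exact: os_projZ. Qed.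

HB.instance Definition _ :=
  GRing.isScalable.Build K E os_alg *:%R os_proj os_proj_scalable.

Lemma os_scalerAl a (u v : os_alg) : a *: (u * v) = a *: u * v.
Proof. exact: mulrA. Qed.

End OrlikSolomon.

Arguments os_proj K {n} M r _.

Definition lin_indep (K : pzRingType) (V : lmodType K) (I : finType)
    (P : pred I) (v : I -> V) : Prop :=
  forall a : I -> K, \sum_(i | P i) a i *: v i = 0 -> forall i, P i -> a i = 0.

(* Main.v *)
Require Import Defs.
From HB Require Import structures.
From mathcomp Require Import all_boot all_order all_algebra.

(* For an r-nbb set S the r-closures X_s of {t in S | s <= t}, s in S, form a *)
(* decreasing flag of r-closed sets with min X_s = s. Let Z send i to the     *)
(* step {s in S | i in X_s} of the flag; the algebra map e_i |-> f_(Z i) to   *)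
(* another exterior algebra commutes with the boundary. If C is a circuit     *)
(* with at most r + 1 elements, Z is not injective on C: otherwise all of C   *)
(* but its outermost element c lies in some X_s with c notin X_s. Hence e_C,  *)
(* and then its boundary, is killed, and the map vanishes on the truncated    *)
(* ideal J_r. If it sends e_T to a multiple of the image of e_S, then T has   *)
(* one element in each step, and it dominates the minimum s of X_s; so T = S  *)
(* or T has larger weight than S, and the independence is triangular.         *)

Set Implicit Arguments.
Unset Strict Implicit.
Unset Printing Implicit Defensive.

Import GRing.Theory.
Local Open Scope ring_scope.

(** Suppose a combination of the monomials of r-nbb sets lies in the truncated ideal. Each r-nbb set
    S gives, through the relabelling [flag_pos], an algebra map [exmap] that kills this ideal
    ([flag_pos_dependent], [exmap_os_trunc]) but not e_S, because [flag_pos] is injective on S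
    ([flag_pos_inj]). Reading off the coefficient at the image of S leaves only S itself and sets of
    larger [weight] ([weight_transversal]), so downward induction on the weight makes every
    coefficient zero. *)

Lemma size_take_drop (A : Type) (s : seq A) k : (k < size s)%N ->
  size (take k s ++ drop k.+1 s) = (size s).-1.
Proof.
move=> ltks; rewrite size_cat size_takel ?(ltnW ltks) // size_drop subnS.
by rewrite -[in RHS](subnKC (ltnW ltks)); case: subn (subn_gt0 k (size s)) => [|d _];
  rewrite ?ltks ?addnS.
Qed.

(** * Unsorted monomials, their boundary, and relabelling maps *)

Section Monomials.
Variable K : comPzRingType.

Lemma exmon_cons n (i : 'I_n) s : exmon K (i :: s) = exgen K i * exmon K s.
Proof. exact: big_cons. Qed.

Lemma exmon_cat n (s t : seq 'I_n) : exmon K (s ++ t) = exmon K s * exmon K t.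
Proof. exact: big_cat. Qed.

Lemma exmon_cat_cons n (s t : seq 'I_n) i :
  exmon K (s ++ i :: t) = (-1) ^+ size s *: exmon K (i :: s ++ t).
Proof.
elim: s => [|j s IHs]; first by rewrite expr0 scale1r.
rewrite /= !exmon_cons IHs exmon_cons -exscalerAr !mulrA exgen_anticomm.
by rewrite mulNr scalerN exprS mulN1r scaleNr.
Qed.

(* The sign is uniform in the relabelling g: this is what makes the algebra   *)
(* map induced by g well defined on unsorted monomials.                       *)
Lemma exmon_map_perm n (s t : seq 'I_n) : perm_eq s t ->
  exists b : nat, forall m (g : 'I_n -> 'I_m),
    exmon K (map g s) = (-1) ^+ b *: exmon K (map g t).
Proof.
elim: s t => [|i s IHs] t pst.
  exists 0%N => m g; rewrite perm_sym in pst.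
  by rewrite (perm_nilP pst) expr0 scale1r.
have it : i \in t by rewrite -(perm_mem pst) mem_head.
case/splitPr: it pst => t1 t2; rewrite perm_sym perm_catC /= perm_cons.
rewrite perm_catC perm_sym => /IHs[b eb]; exists (b + size t1)%N => m g.
rewrite map_cat /= exmon_cat_cons !exmon_cons eb map_cat size_map.
by rewrite -exscalerAr scalerA exprD -mulrA -exprMn mulrNN mulr1 expr1n mulr1.
Qed.

Lemma exmon_perm n (s t : seq 'I_n) : perm_eq s t ->
  exists b : nat, exmon K s = (-1) ^+ b *: exmon K t.
Proof.
by move=> /exmon_map_perm[b eb]; exists b; have := eb n id; rewrite !map_id.
Qed.

Lemma exgen_mon0 n (i : 'I_n) s : i \in s -> exgen K i * exmon K s = 0.
Proof.
elim: s => // j s IHs; rewrite inE exmon_cons mulrA.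
case/orP=> [/eqP <-|/IHs e0]; first by rewrite exgen_sqr mul0r.
by rewrite exgen_anticomm mulNr -mulrA e0 mulr0 oppr0.
Qed.

Lemma exmon_nuniq n (s : seq 'I_n) : ~~ uniq s -> exmon K s = 0.
Proof.
elim: s => //= i s IHs; rewrite negb_and negbK exmon_cons.
by case/orP=> [/exgen_mon0//|/IHs ->]; rewrite mulr0.
Qed.

Lemma exmon_uniq n (s : seq 'I_n) : uniq s ->
  exists b : nat, exmon K s = (-1) ^+ b *: exbasis K [set i in s].
Proof.
move=> us; rewrite -exmon_enum; apply/exmon_perm/uniq_perm; rewrite ?enum_uniq //.
by move=> i; rewrite mem_enum inE.
Qed.

Lemma excoef_mon_set n (s : seq 'I_n) (U : {set 'I_n}) :
  U != [set i in s] -> excoef (exmon K s) U = 0.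
Proof.
move=> nU; have [/exmon_uniq[b ->]|/exmon_nuniq ->] := boolP (uniq s).
  by rewrite excoefZ excoef_basis (negPf nU) mulr0.
exact: excoef0.
Qed.

Lemma excoef_mon_size n (s : seq 'I_n) (U : {set 'I_n}) :
  size s != #|U| -> excoef (exmon K s) U = 0.
Proof.
have [us|/exmon_nuniq -> _] := boolP (uniq s); last exact: excoef0.
move=> nU; apply: excoef_mon_set; apply: contra nU => /eqP ->.
by rewrite cardsE (card_uniqP us).
Qed.

Lemma exbdry_mon_cons n (i : 'I_n) s :
  exbdry_mon K (i :: s) = exmon K s - exgen K i * exbdry_mon K s.
Proof.
rewrite /exbdry_mon big_ord_recl /= expr0 scale1r drop0 mulr_sumr -sumrN.
congr (_ + _); apply: eq_bigr => k _.
by rewrite exmon_cons -exscalerAr /= exprS mulN1r scaleNr.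
Qed.

(** The boundary is an antiderivation: since e_i e_s = 0, the rule for the boundary of e_i e_s
    leaves this identity. *)
Lemma exgen_bdry_mon n (i : 'I_n) s :
  i \in s -> exgen K i * exbdry_mon K s = exmon K s.
Proof.
elim: s => // j s IHs; rewrite inE exbdry_mon_cons mulrBr mulrA exmon_cons.
have [-> _|_ /= si] := eqVneq i j; first by rewrite exgen_sqr mul0r subr0.
by rewrite (exgen_mon0 si) sub0r exgen_anticomm mulNr opprK -mulrA IHs.
Qed.

Lemma exbdry_mon_nuniq n (s : seq 'I_n) : ~~ uniq s -> exbdry_mon K s = 0.
Proof.
elim: s => //= i s IHs; rewrite negb_and negbK exbdry_mon_cons.
have [si _|_ /= us] := boolP (i \in s); first by rewrite exgen_bdry_mon // subrr.
by rewrite exmon_nuniq // IHs // mulr0 subrr.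
Qed.

Section Relabelling.
Variables (n m : nat) (g : 'I_n -> 'I_m).

(** The algebra map e_i |-> e_(g i). As g need be neither monotone nor injective, basis monomials go
    to possibly unsorted, possibly zero products. *)
Definition exmap (x : exterior K n) : exterior K m :=
  \sum_S excoef x S *: exmon K (map g (enum S)).

Fact exmap_zmod : zmod_morphism exmap.
Proof.
move=> x y; rewrite /exmap -sumrB; apply: eq_bigr => S _.
by rewrite excoefD excoefN scalerBl.
Qed.

HB.instance Definition _ := GRing.isZmodMorphism.Build _ _ exmap exmap_zmod.

Fact exmap_scalable : scalable exmap.
Proof.
move=> a x; rewrite /exmap scaler_sumr; apply: eq_bigr => S _.
by rewrite excoefZ scalerA.
Qed.

HB.instance Definition _ := GRing.isScalable.Build K _ _ *:%R exmap exmap_scalable.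

Lemma exmap_mon s : exmap (exmon K s) = exmon K (map g s).
Proof.
have exmap_enum (S : {set 'I_n}) : exmap (exmon K (enum S)) = exmon K (map g (enum S)).
  rewrite exmon_enum /exmap (bigD1 S) //= big1 => [|T /negPf nTS].
    by rewrite excoef_basis eqxx scale1r addr0.
  by rewrite excoef_basis nTS scale0r.
have [us|ns] := boolP (uniq s); last first.
  by rewrite !exmon_nuniq ?raddf0 //; apply: contra ns; apply: map_uniq.
(* Sorting s costs the same sign before and after relabelling. *)
have /exmon_map_perm[b eb]: perm_eq s (enum [set i in s]).
  by apply: uniq_perm; rewrite ?enum_uniq // => i; rewrite mem_enum inE.
by have := eb n id; rewrite !map_id => ->; rewrite linearZ /= exmap_enum eb.
Qed.

Lemma exmapM (x y : exterior K n) : exmap (x * y) = exmap x * exmap y.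
Proof.
rewrite (exbasis_decomp x) (exbasis_decomp y) mulr_suml !raddf_sum mulr_suml.
apply: eq_bigr => S _; rewrite !mulr_sumr raddf_sum /=; apply: eq_bigr => T _.
rewrite -exscalerAl -exscalerAr /= !linearZ /= -exscalerAl -exscalerAr.
by rewrite -!exmon_enum -exmon_cat !exmap_mon map_cat exmon_cat.
Qed.

Lemma exmap_bdry_mon s : exmap (exbdry_mon K s) = exbdry_mon K (map g s).
Proof.
elim: s => [|i s IHs]; first by rewrite /exbdry_mon !big_ord0 raddf0.
rewrite /= !exbdry_mon_cons raddfB /= exmapM exmap_mon IHs.
have -> : exgen K i = exmon K [:: i] by rewrite exmon_cons /exmon big_nil mulr1.
by rewrite exmap_mon /= exmon_cons /exmon big_nil mulr1.
Qed.

End Relabelling.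
End Monomials.

(** * Circuits and r-closed sets *)

Section Closure.
Variables (T : finType) (M : matroid T) (r : nat).
Implicit Types A B C X : {set T}.

Lemma rank_circuit C c : minset [pred A | ~~ indep M A] C -> c \in C ->
  rank M C = rank M (C :\ c).
Proof.
case/minsetP=> /= dC minC cC.
have iCc : indep M (C :\ c).
  by apply: contraT => d; have := minC _ d (subD1set _ _) => eC;
    move: cC; rewrite -eC !inE eqxx.
apply/eqP; rewrite eqn_leq; apply/andP; split; last first.
  apply/bigmax_leqP=> A /andP[AC iA]; apply: leq_bigmax_cond.
  by rewrite iA andbT (subset_trans AC) ?subD1set.
apply: (@leq_trans #|C :\ c|); last first.
  by rewrite /rank (bigmax_sup (C :\ c)) ?subxx.
apply/bigmax_leqP=> A /andP[AC iA].
rewrite -ltnS (leq_trans _ (_ : #|C| <= _)%N) //; last by rewrite (cardsD1 c C) cC.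
apply: proper_card; rewrite properEneq AC andbT.
by apply: contraNneq dC => <-.
Qed.

(** The set [C :\ c] has at most r elements, and by [rank_circuit] its matroid closure contains
    c. *)
Lemma rclosed_circuit X C c : rclosed M r X ->
  minset [pred A | ~~ indep M A] C -> c \in C -> (#|C| <= r.+1)%N ->
  C :\ c \subset X -> c \in X.
Proof.
move=> /forallP/(_ (C :\ c))/implyP clX mC cC leC CX.
apply: (subsetP (clX _)); last by rewrite inE setD1K // (rank_circuit mC cC).
by rewrite CX -ltnS (leq_trans _ leC) // [in X in (_ <= X)%N](cardsD1 c C) cC.
Qed.

Lemma rcl_closed A : rclosed M r (rcl M r A).
Proof.
apply/forallP=> B; apply/implyP=> /andP[BA leB].
apply/bigcapsP=> X /andP[clX AX]; have /implyP := forallP clX B; apply.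
by rewrite leB andbT (subset_trans BA) // bigcap_inf // clX.
Qed.

Lemma sub_rcl A : A \subset rcl M r A.
Proof. by apply/bigcapsP=> X /andP[]. Qed.

Lemma rclS A B : A \subset B -> rcl M r A \subset rcl M r B.
Proof.
move=> AB; apply/bigcapsP=> X /andP[clX BX].
by apply: bigcap_inf; rewrite clX (subset_trans AB).
Qed.

End Closure.

(** * The flag of r-closures attached to S *)

Section Flag.
Variables (T : finType) (M : matroid T) (r : nat) (le : rel T) (S : {set T}).
Hypothesis le_order : linear_order le.

Definition flag (s : T) : {set T} := rcl M r [set j in S | le s j].

(* As the flag is a chain, this set encodes the step of the flag in which i   *)
(* lies; it is empty for i outside the flag.                                  *)
Definition flag_pos (i : T) : {set T} := [set s in S | i \in flag s].

Lemma flag_pos_initial i s t :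
  s \in S -> le s t -> t \in flag_pos i -> s \in flag_pos i.
Proof.
case: le_order => _ _ letr _ sS st; rewrite !inE sS => /andP[_].
apply/subsetP/rclS/subsetP=> j; rewrite !inE => /andP[->]; exact: letr.
Qed.

(** Positions are initial segments of S, hence totally ordered by inclusion, so cardinality
    decides. *)
Lemma flag_pos_sub i j :
  (#|flag_pos i| <= #|flag_pos j|)%N -> flag_pos i \subset flag_pos j.
Proof.
case: le_order => _ _ _ letot leij.
apply: contraT => /subsetPn[s si nsj].
suff ji : flag_pos j \subset flag_pos i.
  by case/negP: nsj; have /eqP -> : flag_pos j == flag_pos i by rewrite eqEcard ji.
apply/subsetP=> t tj; have sS : s \in S by move: si; rewrite inE => /andP[].
have tS : t \in S by move: (tj); rewrite inE => /andP[].
case/orP: (letot s t) => [st|ts]; last exact: flag_pos_initial ts si.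
by rewrite (flag_pos_initial sS st tj) in nsj.
Qed.

Lemma flag_pos_dependent (W : {set T}) : no_loops M ->
  ~~ indep M W -> (#|W| <= r.+1)%N -> ~ {in W &, injective flag_pos}.
Proof.
move=> noloop dW leW inj.
have [C mC CW] := minset_exists (P := [pred A | ~~ indep M A]) dW.
have dC : ~~ indep M C by case/minsetP: mC.
have leC : (#|C| <= r.+1)%N := leq_trans (subset_leq_card CW) leW.
have [c0 c0C] : exists c, c \in C.
  by apply/set0Pn; apply: contraNneq dC => ->; apply: indep0.
(* c is the outermost element of the circuit C, and d below is the outermost of the others; some
   member of the flag then contains d, hence all of [C :\ c], but not c. *)
have [c cC minc] := @arg_minnP _ c0 (mem C) (fun c => #|flag_pos c|) c0C.
have [d0 d0C] : exists d, d \in C :\ c.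
  apply/set0Pn; apply: contraNneq dC => C0.
  by rewrite -(setD1K cC) C0 setU0; apply: noloop.
have [d dC' mind] :=
  @arg_minnP _ d0 (mem (C :\ c)) (fun c => #|flag_pos c|) d0C.
have [/eqP dc dCin] : d != c /\ d \in C by move: dC'; rewrite !inE => /andP[].
have /subsetPn[s sd nsc] : ~~ (flag_pos d \subset flag_pos c).
  apply/negP=> sdc; apply: dc; apply: inj; rewrite ?(subsetP CW) //.
  by apply/eqP; rewrite eqEcard sdc minc.
have sS : s \in S by move: sd; rewrite inE => /andP[].
case/negP: nsc; rewrite inE sS.
apply: rclosed_circuit (rcl_closed _ _ _) mC cC leC _.
apply/subsetP=> e eC; have := subsetP (flag_pos_sub (mind e eC)) s sd.
by rewrite inE => /andP[].
Qed.

Hypothesis nbbS : rnbb M r le S.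

Lemma flag_min s i : s \in S -> i \in flag s -> le s i.
Proof.
move=> sS iX; have /andP[_ /forallP/(_ i)/implyP] := implyP (forallP nbbS s) sS.
exact.
Qed.

Lemma flag_pos_le s i : s \in S -> flag_pos s = flag_pos i -> le s i.
Proof.
case: le_order => lerefl _ _ _ sS eZ.
suff : s \in flag_pos i by rewrite inE => /andP[_ /flag_min]; apply.
by rewrite -eZ inE sS (subsetP (sub_rcl _ _ _)) // inE sS lerefl.
Qed.

Lemma flag_pos_inj : {in S &, injective flag_pos}.
Proof.
case: le_order => _ leanti _ _ s t sS tS eZ; apply: leanti.
by rewrite !flag_pos_le.
Qed.

(** The sum of the ranks of the elements of A in the order [le], counted from 1. *)
Definition weight (A : {set T}) : nat := \sum_(i in A) #|[set j | le j i]|.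

Lemma weight_transversal (A : {set T}) : {in A &, injective flag_pos} ->
  flag_pos @: A = flag_pos @: S -> A != S -> (weight S < weight A)%N.
Proof.
case: le_order => lerefl leanti letr _ injA eAS nAS.
(* h matches i in A with the element of S in the same step; it is a bijection onto S with h i <= i,
   strict somewhere when A differs from S. *)
pose h i := odflt i [pick s in S | flag_pos s == flag_pos i].
have hP i : i \in A -> h i \in S /\ flag_pos (h i) = flag_pos i.
  move=> iA; rewrite /h; case: pickP => [s /andP[sS /eqP]//|no].
  have : flag_pos i \in flag_pos @: S by rewrite -eAS imset_f.
  by case/imsetP=> s sS es; have := no s; rewrite sS es eqxx.
have injh : {in A &, injective h}.
  move=> i j iA jA eh; apply: injA => //.
  by rewrite -(hP i iA).2 -(hP j jA).2 eh.
have hA : h @: A = S.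
  apply/eqP; rewrite eqEcard; apply/andP; split.
    by apply/subsetP=> _ /imsetP[i iA ->]; case: (hP i iA).
  by rewrite (card_in_imset injh) -(card_in_imset injA) eAS
    (card_in_imset flag_pos_inj).
have hle i : i \in A -> le (h i) i.
  by move=> iA; have [hS eh] := hP i iA; apply: flag_pos_le.
have [i iA nhi] : exists2 i, i \in A & h i != i.
  apply/exists_inP; apply: contraT; rewrite negb_exists => /forallP hid.
  case/eqP: nAS; rewrite -hA -[LHS]imset_id; apply: eq_in_imset => i iA.
  by have := hid i; rewrite iA /= negbK => /eqP.
have sub j : j \in A -> [set k | le k (h j)] \subset [set k | le k j].
  by move=> jA; apply/subsetP=> k; rewrite !inE => /letr; apply; apply: hle.
rewrite /weight -{1}hA (big_imset _ injh) /=.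
rewrite (bigD1 i) //= [ltnRHS](bigD1 i) //= -addSn leq_add //; last first.
  by apply: leq_sum => j /andP[/sub/subset_leq_card].
apply: proper_card; rewrite properE sub //=.
apply/subsetPn; exists i; rewrite inE ?lerefl //.
by apply: contra nhi => ih; apply/eqP/leanti; rewrite hle.
Qed.

End Flag.

(** * Relabellings that kill the truncated ideal *)

Section Vanishing.
Variables (K : comPzRingType) (n m : nat) (M : matroid 'I_n) (r : nat).
Variable g : 'I_n -> 'I_m.
Hypothesis g_dependent : forall W : {set 'I_n},
  ~~ indep M W -> (#|W| <= r.+1)%N -> ~ {in W &, injective g}.

(** Elements whose image has no component of degree <= r form an ideal. It contains the generators:
    the small ones die by non-injectivity, the others have a boundary of degree > r. *)
Lemma excoef_exmap_os_ideal x (U : {set 'I_m}) :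
  os_ideal M x -> (#|U| <= r)%N -> excoef (exmap (K := K) g x) U = 0.
Proof.
pose P (x : exterior K n) := forall U : {set 'I_m}, (#|U| <= r)%N ->
  excoef (exmap g x) U = 0.
move=> Ix; suff /(Ix P) : two_sided_ideal P /\
    (forall x : exterior K n, (exists2 S : {set 'I_n}, ~~ indep M S &
       x = exbdry (exmon K (enum S))) -> P x) by apply.
split; first split.
- by move=> V _; rewrite raddf0 excoef0.
- by move=> y z Py Pz V leV; rewrite raddfD excoefD Py // Pz // addr0.
- move=> y z Pz V leV; rewrite exmapM excoefM big1 // => A _.
  by rewrite Pz ?mulr0 // (leq_trans (subset_leq_card (subsetDl _ _)) leV).
- move=> y z Pz V leV; rewrite exmapM excoefM big1 // => A AV.
  by rewrite Pz ?mul0r ?mulr0 // (leq_trans (subset_leq_card AV) leV).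
move=> _ [S dS ->] V leV; rewrite exbdry_enum exmap_bdry_mon.
have [leS|ltS] := leqP #|S| r.+1.
  rewrite exbdry_mon_nuniq ?excoef0 //; apply/negP=> ug.
  by apply: (g_dependent dS leS); apply/dinjectiveP.
rewrite /exbdry_mon excoef_sum big1 // => k _.
rewrite excoefZ excoef_mon_size ?mulr0 // size_take_drop // neq_ltn.
by rewrite size_map -cardE orbC -ltnS prednK ?(leq_ltn_trans _ ltS) ?ltnS.
Qed.

(** A generator has degree <= r and [exmap] preserves degree, so only the components already shown
    to vanish remain. *)
Lemma exmap_os_trunc x : os_trunc M r x -> exmap (K := K) g x = 0.
Proof.
pose P (x : exterior K n) := exmap g x = 0.
move=> Ix; suff /(Ix P) : two_sided_ideal P /\
    (forall x : exterior K n, os_trunc_gen M r x -> P x) by apply.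
split; first split; rewrite /P.
- exact: raddf0.
- by move=> y z Py Pz; rewrite raddfD /= Py Pz addr0.
- by move=> y z Pz; rewrite exmapM Pz mulr0.
- by move=> y z Pz; rewrite exmapM Pz mul0r.
move=> y [Iy degy]; apply/exterior_eqP=> U; rewrite excoef0.
have [leU|ltU] := leqP #|U| r; first exact: excoef_exmap_os_ideal.
rewrite excoef_sum big1 // => S _; rewrite excoefZ.
have [eS|nS] := eqVneq #|S| #|U|; first by rewrite degy ?mul0r // eS.
by rewrite excoef_mon_size ?mulr0 // size_map -cardE.
Qed.

End Vanishing.

Theorem theorem2p25 (K : comPzRingType) (n : nat) (M : matroid 'I_n)
    (r : nat) (le : rel 'I_n) :
  no_loops M -> no_multiple_points M -> (1 <= r)%N -> linear_order le ->
  lin_indep (V := os_alg K M r) (rnbb M r le)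
    (fun S : {set 'I_n} => os_proj K M r (exmon K (sort le (enum S)))).
Proof.
move=> noloop _ _ le_order a a0.
have /os_projP J0 : os_proj K M r
    (\sum_(S | rnbb M r le S) a S *: exmon K (sort le (enum S))) = 0.
  by rewrite raddf_sum -[RHS]a0; apply: eq_bigr => S _; exact: os_projZ.
(* Downward induction on the weight: the heavier r-nbb sets are already known to have coefficient
   0. *)
suff IH k S : rnbb M r le S -> (weight le [set: 'I_n] - weight le S < k)%N ->
    a S = 0 by move=> S nS; apply: IH nS (ltnSn _).
elim: k S => // k IHk S nS ltk.
(* [enum_rank] only turns positions into the ordinals that index generators; its order is
   irrelevant. *)
pose g i := enum_rank (flag_pos M r le S i).
have pS (T : {set 'I_n}) : perm_eq (map g (sort le (enum T))) (map g (enum T)).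
  by rewrite perm_map // perm_sort.
have sS (T : {set 'I_n}) : [set i in map g (sort le (enum T))] = g @: T.
  apply/setP=> i; rewrite inE (perm_mem (pS T)).
  apply/mapP/imsetP=> -[j jT ->]; exists j => //; first by rewrite -mem_enum.
  by rewrite mem_enum.
have g_inj (T : {set 'I_n}) : {in T &, injective g} ->
    {in T &, injective (flag_pos M r le S)}.
  by move=> inj i j iT jT eij; apply: inj => //; rewrite /g eij.
have g_dep (W : {set 'I_n}) : ~~ indep M W -> (#|W| <= r.+1)%N ->
    ~ {in W &, injective g}.
  by move=> dW leW /g_inj; apply: flag_pos_dependent dW leW.
have := congr1 (fun x => excoef x (g @: S)) (exmap_os_trunc g_dep J0).
rewrite raddf_sum excoef0 excoef_sum (bigD1 S) //= big1 ?addr0 => [|T].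
  have /(exmon_uniq K)[b eb] : uniq (map g (sort le (enum S))).
    rewrite (perm_uniq (pS S)); apply/dinjectiveP=> i j iS jS /enum_rank_inj.
    exact: flag_pos_inj.
  rewrite linearZ /= exmap_mon excoefZ eb excoefZ sS excoef_basis eqxx mulr1.
  (* The sign is its own inverse, so it can be cancelled over any ring. *)
  by move/(congr1 ( *%R^~ ((-1) ^+ b))); rewrite -mulrA -exprMn mulrNN mulr1
    expr1n mulr1 mul0r.
case/andP=> nT nTS; rewrite linearZ /= exmap_mon excoefZ.
have [ltST|leTS] := ltnP (weight le S) (weight le T).
  rewrite (IHk T) ?mul0r // -ltnS (leq_trans _ ltk) // ltnS ltn_sub2l //.
  apply: leq_trans ltST _; rewrite /weight [leqRHS](bigID (mem T)) /=.
  rewrite [X in (_ <= X + _)%N](eq_bigl (mem T)) ?leq_addr // => i.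
  by rewrite inE.
have [ug|/exmon_nuniq ->] := boolP (uniq (map g (sort le (enum T)))); last first.
  by rewrite excoef0 mulr0.
rewrite excoef_mon_set ?mulr0 // sS; apply: contraTneq leTS => eST.
rewrite -ltnNge; apply: (@weight_transversal _ M r) => //.
  by apply/g_inj/dinjectiveP; rewrite /dinjectiveb -(perm_uniq (pS T)).
by apply: (imset_inj enum_rank_inj); rewrite -!imset_comp.
Qed.
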